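(* The set $$\left\{f\in C[0,1]: \lambda_f\big(\{y\in\mathbb{R}: f^{-1}(y)\text{ is not perfect}\}\big)>0\right\}$$ is Haar ambivalent in $C[0,1]$.
   Context: $C[0,1]$ is the Banach space of continuous functions $f\colon[0,1]\to\mathbb{R}$ with the supremum metric, regarded as an abelian Polish group under addition. A set $A\subset C[0,1]$ is shy (or Haar null) if there exist a Borel set $B\subset C[0,1]$ and a Borel probability measure $\mu$ on $C[0,1]$ such that $A\subset B$ and $\mu(B+f)=0$ for all $f\in C[0,1]$. A set is prevalent if its complement is shy. A set is Haar ambivalent if it is neither shy nor prevalent. $\lambda$ is one-dimensional Lebesgue measure, and for $f\in C[0,1]$ the occupation measure is $\lambda_f=\lambda\circ f^{-1}$, i.e. $\lambda_f(E)=\lambda(\{x\in[0,1]: f(x)\in E\})$ for Borel $E\subset\mathbb{R}$. A set is perfect if it is closed and has no isolated points (in particular the empty set is perfect). *)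

(* Defs.v *)
From HB Require Import structures.
From mathcomp Require Import all_boot all_order all_algebra.
From mathcomp Require Import all_classical all_reals all_analysis.

Set Implicit Arguments.
Unset Strict Implicit.
Unset Printing Implicit Defensive.

Import Order.TTheory GRing.Theory Num.Theory.
Import numFieldNormedType.Exports.

Local Open Scope classical_set_scope.
Local Open Scope ring_scope.

(* [unit_itv R] coerces to the sigma type [set_type], whose canonical topology
   is the subset topology; unlike functions on [subspace `[0, 1]], functions on
   this type carry no junk values outside [0, 1]. *)
Definition unit_itv (R : realType) : set R := `[0, 1].
Arguments unit_itv : clear implicits.

(* [C01] is a separate constant so that the norm topology below does not clash
   with the instances of [ArrowAsUniformType] and [ArrowAsCompactOpen]. *)
Definition C01 (R : realType) : Type := continuousType (unit_itv R) R.

HB.instance Definition _ (R : realType) := Choice.on (C01 R).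

Section C01_zmod.
Variable R : realType.
Implicit Types f g h : C01 R.

Let cst_cts (T : topologicalType) : continuous (fun _ : T => 0 : R).
Proof. by move=> x; exact: (@cvg_cst R^o). Qed.

Let opp_cts (T : topologicalType) (u : T -> R) :
  continuous u -> continuous (fun x => - u x).
Proof. by move=> cu x; apply: (@cvgN R R^o); exact: cu. Qed.

Let add_cts (T : topologicalType) (u v : T -> R) :
  continuous u -> continuous v -> continuous (fun x => u x + v x).
Proof. by move=> cu cv x; apply: (@cvgD R R^o); [exact: cu|exact: cv]. Qed.

Let scale_cts (T : topologicalType) (a : R) (u : T -> R) :
  continuous u -> continuous (fun x => a * u x).
Proof. by move=> cu x; apply: cvgMl_tmp; exact: cu. Qed.

Definition C01_zero : C01 R := mkcts (@cst_cts (unit_itv R)).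
Definition C01_opp f : C01 R := mkcts (opp_cts (@cts_fun _ _ f)).
Definition C01_add f g : C01 R :=
  mkcts (add_cts (@cts_fun _ _ f) (@cts_fun _ _ g)).
Definition C01_scale (a : R) f : C01 R :=
  mkcts (@scale_cts _ a _ (@cts_fun _ _ f)).

Lemma C01P f g : f =1 g -> f = g.
Proof. by move/continuousEP. Qed.

Let addA : associative C01_add.
Proof. by move=> f g h; apply: C01P => x; exact: addrA. Qed.
Let addC : commutative C01_add.
Proof. by move=> f g; apply: C01P => x; exact: addrC. Qed.
Let add0 : left_id C01_zero C01_add.
Proof. by move=> f; apply: C01P => x; exact: add0r. Qed.
Let addN : left_inverse C01_zero C01_opp C01_add.
Proof. by move=> f; apply: C01P => x; exact: addNr. Qed.

HB.instance Definition _ := GRing.isZmodule.Build (C01 R) addA addC add0 addN.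

Let scaleA a b f : C01_scale a (C01_scale b f) = C01_scale (a * b) f.
Proof. by apply: C01P => x; exact: mulrA. Qed.
Let scale1 : left_id 1 C01_scale.
Proof. by move=> f; apply: C01P => x; exact: mul1r. Qed.
Let scaleDr : right_distributive C01_scale +%R.
Proof. by move=> a f g; apply: C01P => x; exact: mulrDr. Qed.
Let scaleDl f : {morph C01_scale^~ f : a b / a + b}.
Proof. by move=> a b; apply: C01P => x; exact: mulrDl. Qed.

HB.instance Definition _ := GRing.Zmodule_isLmodule.Build R (C01 R)
  scaleA scale1 scaleDr scaleDl.

Lemma C01_zeroE x : (0 : C01 R) x = 0. Proof. by []. Qed.
Lemma C01_oppE f x : (- f) x = - f x. Proof. by []. Qed.
Lemma C01_addE f g x : (f + g) x = f x + g x. Proof. by []. Qed.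
Lemma C01_scaleE (a : R) f x : (a *: f) x = a * f x. Proof. by []. Qed.

Definition C01_norm f : R := sup (range (fun x => `|f x|)).

Lemma C01_bounded f : has_ubound (range (fun x => `|f x|)).
Proof.
have cf : {within unit_itv R, continuous (valL f)}.
  by apply/subspace_valL_continuousP; exact: cts_fun.
have /compact_bounded[M [_ Mb]] :=
  continuous_compact cf (@segment_compact R 0 1).
exists (M + 1) => _ [x _ <-]; apply: (Mb (M + 1)); first by rewrite ltrDl.
exists (set_val x); first exact: set_valP.
exact: (congr1 (@^~ x) (valLK point (f : unit_itv R -> R))).
Qed.

Lemma C01_le_norm f x : `|f x| <= C01_norm f.
Proof. by apply: ub_le_sup; [exact: C01_bounded|exists x]. Qed.

Lemma unit_itv0 : 0 \in unit_itv R.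
Proof. by rewrite inE /unit_itv/= in_itv/= lexx ler01. Qed.

Lemma C01_norm_le f (M : R) : (forall x, `|f x| <= M) -> C01_norm f <= M.
Proof.
move=> fM; apply: ge_sup; last by move=> _ [x _ <-].
by exists `|f (exist _ 0 unit_itv0)|; exists (exist _ 0 unit_itv0).
Qed.

Let norm_triangle f g : C01_norm (f + g) <= C01_norm f + C01_norm g.
Proof.
apply: C01_norm_le => x; rewrite C01_addE (le_trans (ler_normD _ _))//.
by rewrite lerD// C01_le_norm.
Qed.

Let normZ (a : R) f : C01_norm (a *: f) = `|a| * C01_norm f.
Proof.
have [->|a0] := eqVneq a 0.
  rewrite normr0 mul0r scale0r; apply/eqP; rewrite eq_le; apply/andP; split.
    by apply: C01_norm_le => x; rewrite C01_zeroE normr0.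
  by apply: le_trans (C01_le_norm 0 (exist _ 0 unit_itv0)).
apply/eqP; rewrite eq_le; apply/andP; split.
  by apply: C01_norm_le => x; rewrite C01_scaleE normrM ler_wpM2l// C01_le_norm.
rewrite -ler_pdivlMl ?normr_gt0//; apply: C01_norm_le => x.
by rewrite ler_pdivlMl ?normr_gt0// -normrM -C01_scaleE C01_le_norm.
Qed.

Let norm0_eq0 f : C01_norm f = 0 -> f = 0.
Proof.
move=> f0; apply: C01P => x; apply/eqP; rewrite -normr_le0 -f0.
exact: C01_le_norm.
Qed.

HB.instance Definition _ := Lmodule_isNormed.Build R (C01 R)
  norm_triangle normZ norm0_eq0.

(* The topology of [C01 R] is the one of this norm. *)
Lemma C01_normE f : `|f| = sup (range (fun x => `|f x|)).
Proof. by []. Qed.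

End C01_zmod.

Section C01_complete.
Variable R : realType.

Lemma C01_complete (F : set_system (C01 R)) :
  ProperFilter F -> cauchy F -> cvg F.
Proof.
move=> FF /cauchy_ballP cF.
pose j := (id : C01 R -> arrow_uniform_type (unit_itv R) R).
have cjF : cauchy (j @ F).
  apply/cauchy_ballP => e e0; rewrite near_map2.
  apply: filterS (cF e e0) => -[f g] /=; rewrite -ball_normE/= => fg x.
  rewrite -ball_normE/=; apply: le_lt_trans fg; exact: (C01_le_norm (f - g) x).
have := fun_complete cjF; set u := (X in _ --> X) => /(_ _)Fu.
have cu : continuous (u : unit_itv R -> R).
  apply: (@uniform_limit_continuous _ _ (j @ F)).
    rewrite near_map; apply: filterE => f; exact: (@cts_fun _ _ f).
  by rewrite uniform_nbhsT; exact: Fu.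
apply/cvg_ex; exists (mkcts cu : C01 R); apply/fcvg_ballP => e e0.
have e20 : 0 < e / 2 by rewrite divr_gt0.
have uF : F [set f | ball u (e / 2) (j f)] by exact: (cvg_ball Fu e20).
apply: (filterS _ uF) => f /= uf; rewrite -ball_normE/=.
apply: (@le_lt_trans _ _ (e / 2)); last by rewrite ltr_pdivrMr// ltr_pMr// ltr1n.
by apply: C01_norm_le => x; have := uf x; rewrite -ball_normE/= => /ltW.
Qed.

HB.instance Definition _ := Uniform_isComplete.Build (C01 R) C01_complete.

End C01_complete.

Section haar.
Context (R : realType) (G : completeNormedModType R).

Definition borel := g_sigma_algebraType (@open G).

Definition translate (B : set G) (f : G) : set G := [set g + f | g in B].

Definition shy (A : set G) := exists (B : set G) (mu : probability borel R),
  [/\ measurable (B : set borel), A `<=` B &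
      forall f : G, mu (translate B f) = 0%E].

Definition prevalent (A : set G) := shy (~` A).

Definition haar_ambivalent (A : set G) := ~ shy A /\ ~ prevalent A.

End haar.

(* [E |-> lambda {x in [0, 1] | f x \in E}]; the image under [\val] moves the
   preimage from the sigma type back to R. On non-Borel sets
   [lebesgue_measure] is the outer measure. *)
Definition occupation_measure (R : realType) (f : C01 R) (E : set R) : \bar R :=
  lebesgue_measure [set \val x | x in f @^-1` E].

(* Main.v *)
From HB Require Import structures.
Require Import Defs.
From mathcomp Require Import all_boot all_order all_algebra.
From mathcomp Require Import all_classical all_reals all_analysis.
From mathcomp Require Import measurable_realfun ring lra.

(** Every Borel probability measure on C[0,1] charges a set [equicts d] of
    functions with a common modulus of continuity [d] ([probability_equicts]).
    To refute shyness or prevalence it thus suffices to handle one such family,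
    by perturbations that oscillate, or rise, much faster than [d] permits.

    The set is not prevalent. By Baire's theorem there is a [g] which, at
    arbitrarily fine scales, is a triangle wave of amplitude far larger than
    the oscillation at that scale of the remaining part of [f + g], for all [f]
    in [equicts d] together ([exists_sawtooth]). Then [f + g] has no isolated
    crossing of a level ([sawtooth_no_crossing]), so the isolated points of
    its levels are local extrema and only countably many levels fail to be
    perfect ([not_perfect_extremal]); moreover each level is Lebesgue null
    ([sawtooth_level]). So the translate of [equicts d] by [g] avoids the set.

    The set is not shy. On a short interval, add to [f] a devil's staircase [G]
    that rises from 0 to 1 on a set so thin that functions of modulus [d]
    hardly vary along it ([staircase_steep]). Two points of that interval on
    one level of [f + G] force this level to be very near one of
    countably many values, so the levels attained exactly once on the interval
    form a set [W] of positive Lebesgue measure ([exists_isolating]). The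
    occupation measure of [f + G] may be singular and miss [W]. Therefore the part
    of the graph over the staircase is shifted vertically by a parameter [t],
    which replaces [W] by [W + t] without any change over [0, 1/2]: by Tonelli's
    theorem the occupation measure over [0, 1/2] charges [W + t] for a set of
    parameters [t] of positive measure ([occupation_meets]). A second
    application of Tonelli's theorem, in [(f, t)], contradicts the existence of a
    Borel hull all of whose translates are null. *)

Set Implicit Arguments.
Unset Strict Implicit.
Unset Printing Implicit Defensive.

Import Order.TTheory GRing.Theory Num.Theory.
Import numFieldNormedType.Exports.

Local Open Scope classical_set_scope.
Local Open Scope ring_scope.

(** * Continuous functions on the unit interval and their levels *)

Section extension.
Variable R : realType.
Implicit Types (f g : C01 R) (x y : R).

Definition clamp x : R := Num.max 0 (Num.min x 1).

Lemma clamp01 x : 0 <= clamp x <= 1.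
Proof. by rewrite /clamp le_max lexx ge_max ler01 ge_min lexx orbT. Qed.

Lemma clampK x : 0 <= x <= 1 -> clamp x = x.
Proof. by move=> /andP[x0 x1]; rewrite /clamp (min_idPl x1) (max_idPr x0). Qed.

Lemma clamp_lipschitz x y : `|clamp x - clamp y| <= `|x - y|.
Proof.
rewrite /clamp /Num.max /Num.min.
case: (ltP x 1) => ?; case: (ltP y 1) => ?; rewrite ?ltr01;
  try case: (ltP 0 x) => ?; try case: (ltP 0 y) => ?;
  rewrite ?subrr ?normr0 ?normr_ge0// ler_norml; apply/andP; split;
  have := ler_norm (x - y); have := lerNnormlW (lexx `|x - y|); lra.
Qed.

Lemma clamp_unit x : clamp x \in unit_itv R.
Proof. by rewrite inE /unit_itv /= in_itv /= clamp01. Qed.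

Definition unit_proj x : unit_itv R := exist _ (clamp x) (clamp_unit x).

Lemma unit_val01 (u : unit_itv R) : 0 <= set_val u <= 1.
Proof. by have := set_valP u; rewrite /unit_itv /= in_itv. Qed.

Lemma unit_projK (u : unit_itv R) : unit_proj (set_val u) = u.
Proof. by apply: val_inj; rewrite /= clampK// unit_val01. Qed.

(** The derived properties are easier on the line than on the sigma type: [ext f]
    prolongs [f] by constants, which preserves moduli of continuity. *)
Definition ext f x : R := f (unit_proj x).

Lemma ext_val f (u : unit_itv R) : ext f (set_val u) = f u.
Proof. by rewrite /ext unit_projK. Qed.

Lemma clamp_cts : continuous clamp.
Proof.
move=> x; apply/cvgrPdist_le => /= e e0; near=> y.
by rewrite (le_trans (clamp_lipschitz _ _))//; near: y; exact: cvgr_dist_le.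
Unshelve. all: by end_near. Qed.

Lemma unit_proj_cts : continuous unit_proj.
Proof. by apply: continuous_comp_initial; exact: clamp_cts. Qed.

Lemma ext_cts f : continuous (ext f).
Proof.
by move=> x; apply: continuous_comp; [exact: unit_proj_cts|exact: cts_fun].
Qed.

Lemma extD f g x : ext (f + g) x = ext f x + ext g x. Proof. by []. Qed.
Lemma extN f x : ext (- f) x = - ext f x. Proof. by []. Qed.
Lemma extZ (a : R) f x : ext (a *: f) x = a * ext f x. Proof. by []. Qed.

Lemma ext_le_norm f x : `|ext f x| <= `|f|.
Proof. exact: C01_le_norm. Qed.

Lemma norm_le_ext f (M : R) :
  (forall x, 0 <= x <= 1 -> `|ext f x| <= M) -> `|f| <= M.
Proof.
move=> fM; apply: C01_norm_le => u.
by rewrite -ext_val; apply: fM; exact: unit_val01.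
Qed.

Lemma comp_val_cts (h : R -> R) :
  continuous h -> continuous (h \o (set_val : unit_itv R -> R)).
Proof.
move=> ch u; apply: continuous_comp; last exact: ch.
exact: initial_continuous.
Qed.

Definition restr (h : R -> R) (ch : continuous h) : C01 R :=
  mkcts (comp_val_cts ch).

Lemma ext_restr (h : R -> R) (ch : continuous h) x :
  0 <= x <= 1 -> ext (restr ch) x = h x.
Proof. by move=> x01; rewrite -[LHS]/(h (clamp x)) clampK. Qed.

Lemma unit_ballE (u v : unit_itv R) (e : R) :
  ball u e v = (`|set_val u - set_val v| < e).
Proof. by []. Qed.

Definition isolated_preimage f x :=
  exists2 e, 0 < e & forall x', 0 <= x' <= 1 -> `|x' - x| < e ->
    ext f x' = ext f x -> x' = x.

Lemma not_perfectP f y : ~ perfect_set (f @^-1` [set y]) <->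
  exists x, [/\ 0 <= x <= 1, ext f x = y & isolated_preimage f x].
Proof.
split.
- move=> np; apply: contrapT => nx; apply: np; split.
    apply: closed_comp; last exact: closed_eq.
    by move=> u _; exact: cts_fun.
  apply/seteqP; split => u.
    move=> lu; suff : closure (f @^-1` [set y]) u.
      rewrite -(closure_id _).1//; apply: closed_comp; last exact: closed_eq.
      by move=> v _; exact: cts_fun.
    exact: subset_limit_point.
  move=> /= fuy U nU; apply: contrapT => noy; apply: nx.
  exists (set_val u); split; [exact: unit_val01|by rewrite ext_val|].
  move: nU => /nbhs_ballP[e /= e0 eU]; exists e => // x' x'01 x'u fx'.
  apply: contrapT => x'nu; apply: noy; exists (unit_proj x'); split.
  + apply/eqP => /(congr1 set_val); rewrite set_valE /= clampK//.
  + by rewrite /= -[LHS]/(ext f x') fx' ext_val.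
  + apply: eU; rewrite unit_ballE /= -[set_val (unit_proj x')]/(clamp x').
    by rewrite clampK// distrC.
- move=> [x [x01 fxy [e e0 ex]]] [_ lE].
  have : (f @^-1` [set y]) (unit_proj x) by exact: fxy.
  rewrite -lE => /(_ (ball (unit_proj x) e))[].
    exact: nbhsx_ballx.
  move=> u [/eqP uneq fu]; rewrite unit_ballE /= -[set_val (unit_proj x)]/(clamp x) => bu.
  apply: uneq; rewrite -[u]unit_projK; congr unit_proj.
  apply: ex; first exact: unit_val01.
    by move: bu; rewrite clampK// distrC.
  by rewrite ext_val fxy.
Qed.

Lemma occupation_measureE f (E : set R) : occupation_measure f E =
  lebesgue_measure [set x | 0 <= x <= 1 /\ E (ext f x)].
Proof.
rewrite /occupation_measure; congr (lebesgue_measure _).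
apply/seteqP; split => [_ [u fu <-]|x [x01 Ex]].
  by split; [exact: unit_val01|rewrite ext_val].
by exists (unit_proj x) => //=; rewrite clampK.
Qed.

(** The equicontinuity half of the Arzela-Ascoli criterion: functions with the common
    modulus of continuity [d]. *)
Definition equicts (d : nat -> R) : set (C01 R) :=
  [set f | forall n x y, `|x - y| <= d n -> `|ext f x - ext f y| <= n.+1%:R^-1].

(** Heine's theorem, by compactness of [[0, 1]] uniformly along the filter of
    scales [m -> oo]. *)
Lemma heine f (e : R) : 0 < e -> exists m : nat,
  forall x y, `|x - y| <= m.+1%:R^-1 -> `|ext f x - ext f y| <= e.
Proof.
move=> e0.
have /compact_near_coveringP/(_ nat \oo
  (fun m x => forall y, `|x - y| <= m.+1%:R^-1 -> `|ext f x - ext f y| <= e) _) :=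
  @segment_compact R 0 1.
case.
  move=> x _; have e2 : 0 < e / 2 by rewrite divr_gt0.
  have /cvgrPdist_le/(_ _ e2)/nbhs_ballP[r /= r0 rx] := @ext_cts f x.
  have r2 : 0 < r / 2 by rewrite divr_gt0.
  exists (ball x (r / 2), [set m | m.+1%:R^-1 <= r / 2]).
    split => /=; first exact: nbhsx_ballx.
    have := near_infty_natSinv_lt (PosNum r2); apply: filterS => m /= /ltW//.
  move=> [x' m] /= [xx' mr] y x'y.
  have -> : ext f x' - ext f y = (ext f x - ext f y) - (ext f x - ext f x').
    by lra.
  rewrite (le_trans (ler_normB _ _))// [leRHS](splitr e) lerD//; apply: rx.
    rewrite /ball /=; rewrite (le_lt_trans (ler_distD x' _ _))//.
    rewrite [ltRHS](splitr r) ltr_leD//.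
    exact: le_trans x'y mr.
  rewrite /ball /= in xx' *; rewrite (lt_trans xx')//.
  by rewrite ltr_pdivrMr// ltr_pMr// ltr1n.
move=> m _ /(_ m (leqnn m)) mP; exists m => x y xy.
have := mP (clamp x).
rewrite /= in_itv /= clamp01 => /(_ isT (clamp y)).
have clampE z : ext f (clamp z) = ext f z.
  by rewrite -[clamp z]/(set_val (unit_proj z)) ext_val.
by rewrite !clampE; apply; rewrite (le_trans (clamp_lipschitz _ _)).
Qed.

End extension.

(** * Equicontinuous families of positive measure *)

Section tightness.
Variable R : realType.

Lemma borel_open (G : completeNormedModType R) (U : set G) :
  open U -> measurable (U : set (borel G)).
Proof. by move=> oU; exact: sub_sigma_algebra. Qed.

Lemma borel_closed (G : completeNormedModType R) (U : set G) :
  closed U -> measurable (U : set (borel G)).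
Proof.
by move=> cU; rewrite -[U]setCK; apply: measurableC; apply: borel_open; rewrite openC.
Qed.

Definition osc_le (r e : R) : set (C01 R) :=
  [set f | forall x y, `|x - y| <= r -> `|ext f x - ext f y| <= e].

(** The oscillation bound is a conjunction of closed conditions: a violation by
    [f] persists on the ball whose radius is a quarter of its excess. *)
Lemma closed_osc_le r e : closed (osc_le r e).
Proof.
rewrite -[osc_le r e]setCK closedC openE => f /= /existsNP[x /existsNP[y]].
move=> /not_implyP[xy /negP]; rewrite -ltNge => fxy.
apply/nbhs_ballP; exists ((`|ext f x - ext f y| - e) / 4) => /=.
  by rewrite divr_gt0// subr_gt0.
move=> g; rewrite -ball_normE /= => fg /(_ x y xy).
apply/negP; rewrite -ltNge.
have := ext_le_norm (f - g) x; have := ext_le_norm (f - g) y.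
rewrite !extD !extN => h1 h2.
have h3 : ext f x - ext f y = (ext f x - ext g x) + (ext g x - ext g y)
  - (ext f y - ext g y) by lra.
have := ler_normB ((ext f x - ext g x) + (ext g x - ext g y))
  (ext f y - ext g y).
rewrite -h3; have := ler_normD (ext f x - ext g x) (ext g x - ext g y).
lra.
Qed.

Lemma equictsE d : equicts d = \bigcap_n osc_le (d n) n.+1%:R^-1.
Proof.
by apply/seteqP; split => [f fd n _ x y|f fd n x y]; [exact: fd|exact: (fd n I)].
Qed.

Lemma measurable_equicts d : measurable (equicts d : set (borel (C01 R))).
Proof.
rewrite equictsE; apply: bigcapT_measurable => n.
by apply: borel_closed; exact: closed_osc_le.
Qed.

(** Every continuous function has some scale [r], so the sets [osc_le r e] increase to
    the whole space as [r] decreases to [0], and their measures tend to [1]. *)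
Lemma probability_osc_le (mu : probability (borel (C01 R)) R) (e p : R) :
  0 < e -> 0 < p -> exists2 r, 0 < r & (mu (~` osc_le r e) <= p%:E)%E.
Proof.
move=> e0 p0; pose F (m : nat) : set (borel (C01 R)) := ~` osc_le m.+1%:R^-1 e.
have mF m : measurable (F m).
  by apply: measurableC; apply: borel_closed; exact: closed_osc_le.
have F0 : \bigcap_m F m = set0.
  apply/seteqP; split => // f fF; have [m fm] := heine f e0.
  by apply: (fF m I) => x y xy; exact: fm.
have : mu \o F @ \oo --> mu (\bigcap_n F n).
  apply: nonincreasing_cvg_mu => //.
  - by rewrite (le_lt_trans (probability_le1 _ _))// ltry.
  - by rewrite F0.
  - move=> m n mn; apply/subsetPset; apply: subsetC => f fm x y xy; apply: fm.
    by rewrite (le_trans xy)// lef_pV2 ?posrE// ler_nat.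
rewrite F0 measure0 => /fine_cvgP[ffin /cvgrPdist_lt/(_ _ p0)].
move=> /(filterI ffin) [N _ /(_ N (leqnn N))[/= fN Np]].
exists N.+1%:R^-1 => //; rewrite -[X in (X <= _)%E]/(mu (F N)).
rewrite -(fineK fN) lee_fin; move: Np; rewrite sub0r normrN => /ltW.
by apply: le_trans; exact: ler_norm.
Qed.

(** The equicontinuity half of tightness: the exceptional masses for the successive precisions
    [1/(n+1)] are made to sum to at most [1/2]. *)
Lemma probability_equicts (mu : probability (borel (C01 R)) R) :
  exists d, (forall n, 0 < d n) /\ (0 < mu (equicts d))%E.
Proof.
have H n : exists r, 0 < r /\
    (mu (~` osc_le r n.+1%:R^-1) <= ((2^-1) / (2 ^ n.+1)%:R)%:E)%E.
  have [||r r0 ?] := @probability_osc_le mu n.+1%:R^-1 ((2^-1) / (2 ^ n.+1)%:R).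
  - by [].
  - by rewrite divr_gt0// ltr0n expn_gt0.
  - by exists r.
have [d dP] := choice H; exists d; split; first by move=> n; have [] := dP n.
have mK := measurable_equicts d.
have := @probability_setC _ _ _ mu _ mK.
suff : (mu (~` equicts d) <= 2^-1%:E)%E.
  move=> h muC; rewrite ltNge; apply/negP => mu0.
  have {}mu0 : mu (equicts d) = 0%E by apply/eqP; rewrite eq_le mu0 measure_ge0.
  move: h; rewrite muC mu0 sube0 lee_fin; lra.
rewrite equictsE setC_bigcap.
have mO n : measurable (~` osc_le (d n) n.+1%:R^-1 : set (borel (C01 R))).
  by apply: measurableC; apply: borel_closed; exact: closed_osc_le.
have mU := bigcupT_measurable _ mO.
apply: (le_trans (measure_sigma_subadditive mu mO mU (@subset_refl _ _))).
apply: (le_trans _ (@epsilon_trick0 R 2^-1 xpredT _)); last by rewrite invr_ge0.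
by apply: lee_nneseries => n _ //; exact: (dP n).2.
Qed.

End tightness.

(** * A triangle wave *)

Section triangle_wave.
Variable R : realType.
Implicit Types (u v x y : R) (m k : int).

(** The distance from [u] to the nearest even integer: a triangle wave of period [2]
    between [0] and [1]; as a distance it is visibly 1-Lipschitz. *)
Definition tri u : R := `|u - (2 * Num.floor ((u + 1) / 2))%:~R|.

(** Distinct even integers are at distance at least [2], so one at distance at most
    [1] from [u] is a nearest one. *)
Lemma even_nearest u m k : `|u - (2 * m)%:~R| <= 1 ->
  `|u - (2 * m)%:~R| <= `|u - (2 * k)%:~R|.
Proof.
have [->//|km um] := eqVneq k m; apply: (le_trans um).
have {}km : 2 <= `|(2 * m)%:~R - (2 * k)%:~R| :> R.
  rewrite -intrB -mulrBr intrM normrM -[leLHS]mulr1 ger0_norm// ler_pM2l//.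
  by rewrite -intr_norm -[1]/(1%:~R) ler_int -gtz0_ge1 normr_gt0 subr_eq0 eq_sym.
have := ler_distD u (2 * m)%:~R (2 * k)%:~R.
rewrite [`|_ - u|]distrC; lra.
Qed.

Lemma tri_floor_le1 u : `|u - (2 * Num.floor ((u + 1) / 2))%:~R| <= 1.
Proof.
have /andP[] := floor_itv ((u + 1) / 2).
rewrite intrM intrD ler_norml; set k : R := (Num.floor _)%:~R.
rewrite -[1%:~R]/(1 : R) -[2%:~R]/(2 : R) => h1 h2; apply/andP; split; lra.
Qed.

Lemma tri_le_dist u m : tri u <= `|u - (2 * m)%:~R|.
Proof. exact/even_nearest/tri_floor_le1. Qed.

Lemma triE u m : `|u - (2 * m)%:~R| <= 1 -> tri u = `|u - (2 * m)%:~R|.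
Proof.
by move=> um; apply/eqP; rewrite eq_le tri_le_dist/= even_nearest.
Qed.

Lemma tri_ge0 u : 0 <= tri u. Proof. exact: normr_ge0. Qed.
Lemma tri_le1 u : tri u <= 1. Proof. exact: tri_floor_le1. Qed.

Lemma tri_lipschitz u v : `|tri u - tri v| <= `|u - v|.
Proof.
have H x y : tri x - tri y <= `|x - y|.
  rewrite lerBlDr (le_trans (tri_le_dist x (Num.floor ((y + 1) / 2))))//.
  exact: ler_distD.
by rewrite ler_norml lerNl opprB {1}distrC !H.
Qed.

Lemma tri_even m : tri (2 * m)%:~R = 0.
Proof. by rewrite (@triE _ m) subrr normr0. Qed.

Lemma tri_odd m : tri ((2 * m)%:~R + 1) = 1.
Proof. by rewrite (@triE _ m) addrAC subrr add0r normr1. Qed.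

Lemma tri_extremal_left u (s : R) : s = 0 \/ s = 1 ->
  exists p, [/\ u - 2 <= p, p < u & tri p = s].
Proof.
move=> s01.
have [m [m1 m2]] : exists m, u - s - 2 <= (2 * m)%:~R /\ (2 * m)%:~R < u - s.
  exists (Num.ceil ((u - s) / 2) - 1).
  have := ceil_ge ((u - s) / 2); have := ceilB1_lt ((u - s) / 2).
  rewrite intrM intrB; set k : R := (Num.ceil _)%:~R.
  rewrite -[1%:~R]/(1 : R) -[2%:~R]/(2 : R) => h1 h2; split; lra.
exists ((2 * m)%:~R + s); split; [lra|lra|].
by case: s01 => ->; rewrite ?addr0 ?tri_even ?tri_odd.
Qed.

Lemma tri_opp u : tri (- u) = tri u.
Proof.
have H v : tri (- v) <= tri v.
  have := tri_le_dist (- v) (- Num.floor ((v + 1) / 2)).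
  by rewrite mulrN intrN -opprD normrN.
by apply/eqP; rewrite eq_le H/= -{1}(opprK u) H.
Qed.

Lemma tri_extremal_right u (s : R) : s = 0 \/ s = 1 ->
  exists p, [/\ u < p, p <= u + 2 & tri p = s].
Proof.
move=> /(@tri_extremal_left (- u) s)[p [p1 p2 ps]].
by exists (- p); rewrite tri_opp; split => //; lra.
Qed.

(** Between consecutive integers the wave is affine of slope [1] or [-1]; this is what
    bounds the measure of its level sets. *)
Lemma tri_cell (j : nat) u : j%:R <= u <= j.+1%:R ->
  tri u = if odd j then j.+1%:R - u else u - j%:R.
Proof.
move=> /andP[ju uj]; case: ifPn => oj.
  have jE : j.+1%:R = (2 * (uphalf j)%:Z)%:~R :> R.
    rewrite intrM -[2%:~R]/(2 : R) -[(uphalf j)%:~R]/((uphalf j)%:R : R) -natrM.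
    by rewrite mul2n uphalf_half oj add1n doubleS -[in LHS](odd_double_half j) oj.
  move: ju uj; rewrite -natr1; rewrite -natr1 in jE.
  by rewrite jE => ? ?; rewrite (@triE _ (uphalf j)) -jE distrC ger0_norm//; lra.
have jE : j%:R = (2 * (j./2)%:Z)%:~R :> R.
  rewrite intrM -[2%:~R]/(2 : R) -[(j./2)%:~R]/((j./2)%:R : R) -natrM.
  by rewrite mul2n -[in LHS](odd_double_half j) (negbTE oj).
by rewrite -natr1 in uj; rewrite (@triE _ j./2) -jE ger0_norm//; lra.
Qed.

End triangle_wave.

(** * Null sets and functions oscillating at all scales *)

Section null_sets.
Variable R : realType.
Implicit Types A B : set R.

(** [lebesgue_measure] is the outer measure on all sets, so monotonicity and
    subadditivity hold without measurability. *)
Lemma leb_mono A B : A `<=` B -> (lebesgue_measure A <= lebesgue_measure B)%E.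
Proof. exact: (@le_outer_measure _ _ (mu_ext (wlength idfun))). Qed.

Lemma leb_bigcup (F : (set R)^nat) :
  (lebesgue_measure (\bigcup_n F n) <= \sum_(n <oo) lebesgue_measure (F n))%E.
Proof. exact: (@outer_measure_sigma_subadditive _ _ (mu_ext (wlength idfun))). Qed.

Lemma leb_bigsetU (F : (set R)^nat) n :
  (lebesgue_measure (\big[setU/set0]_(i < n) F i)
     <= \sum_(i < n) lebesgue_measure (F i))%E.
Proof. exact: (@outer_measure_subadditive _ _ (mu_ext (wlength idfun))). Qed.

Lemma leb_ge0 A : (0 <= lebesgue_measure A)%E.
Proof. exact: (@outer_measure_ge0 _ _ (mu_ext (wlength idfun))). Qed.

Lemma null_countable_bigcup (T : countType) (F : T -> set R) :
  (forall t, lebesgue_measure (F t) = 0%E) ->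
  lebesgue_measure (\bigcup_t F t) = 0%E.
Proof.
move=> F0; pose G n := if @unpickle T n is Some t then F t else set0.
apply/eqP; rewrite eq_le leb_ge0 andbT.
have -> : \bigcup_t F t = \bigcup_n G n.
  apply/seteqP; split => x [t _ Ftx].
    by exists (pickle t) => //; rewrite /G pickleK.
  by move: Ftx; rewrite /G; case: unpickle => // s Fsx; exists s.
apply: (le_trans (leb_bigcup G)); rewrite eseries0// => n _ _.
by rewrite /G; case: unpickle => // ; rewrite measure0.
Qed.

Lemma leb_small A (C : R) :
  (forall n, (lebesgue_measure A <= (C / n.+1%:R)%:E)%E) ->
  lebesgue_measure A = 0%E.
Proof.
move=> AC; apply/eqP; rewrite eq_le leb_ge0 andbT.
have Afin : lebesgue_measure A \is a fin_num.
  by rewrite ge0_fin_numE ?leb_ge0// (le_lt_trans (AC 0%N))// ltry.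
rewrite -(fineK Afin) lee_fin leNgt; apply/negP => A0.
set l := fine _ in A0; pose n := Num.truncn (C / l).
have := AC n; rewrite -(fineK Afin) lee_fin -/l; apply/negP; rewrite -ltNge.
by rewrite ltr_pdivrMr// mulrC -ltr_pdivrMr// /n truncnS_gt.
Qed.

End null_sets.

Section sawtooth.
Variable R : realType.

(** At one scale [1/M < 1/n], the function [F] is a triangle wave of amplitude [a] up to
    errors small compared to [a]: the carrier [H] barely moves over a period. *)
Definition sawtooth (F : R -> R) (n : nat) := exists (H : R -> R) (a : R) (M : nat),
  [/\ 0 < a, (n < M)%N,
   forall x y, `|x - y| <= 2 / M%:R -> `|H x - H y| <= a / n.+1%:R &
   forall x, 0 <= x <= 1 -> `|F x - (H x + a * tri (M%:R * x))| <= a / n.+1%:R].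

(** Each of the [M] cells of length [1/M] meets the level in a set of diameter
    [O(1/(n M))], since there [F] follows an affine function of slope [a M] up to [O(a/n)]. *)
Lemma sawtooth_level (F : R -> R) n y : sawtooth F n ->
  (lebesgue_measure [set x | 0 <= x <= 1 /\ F x = y]%R <= (4 / n.+1%:R)%:E)%E.
Proof.
move=> [H [a [M [a0 nM Hosc FH]]]].
have M0 : 0 < M%:R :> R by rewrite ltr0n (leq_ltn_trans _ nM).
set N : R := n.+1%:R; have N0 : 0 < N by rewrite ltr0n.
pose r : R := 2 / (N * M%:R).
have r0 : 0 < r by rewrite divr_gt0// mulr_gt0.
pose w (j : nat) := (y - H (j%:R / M%:R)) / a.
pose c (j : nat) : R := (if odd j then j.+1%:R - w j else j%:R + w j) / M%:R.
pose I j := `[c j - r, c j + r]%classic.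
apply: (@le_trans _ _ (lebesgue_measure (\big[setU/set0]_(i < M) I i))).
  apply: leb_mono => x /= [x01 Fxy].
  have [j jM /andP[jx xj]] : exists2 j : nat, (j < M)%N & j%:R <= M%:R * x <= j.+1%:R.
    have Mx0 : 0 <= M%:R * x by case/andP: x01 => ? _; rewrite mulr_ge0.
    have /andP[h1 h2] := truncn_itv Mx0.
    have [jM|Mj] := ltnP (Num.truncn (M%:R * x)) M.
      by exists (Num.truncn (M%:R * x)) => //; rewrite h1 ltW.
    have xM : M%:R * x <= M%:R by case/andP: x01 => _ ?; rewrite ler_piMr.
    have M1 : (0 < M)%N by rewrite (leq_ltn_trans _ nM).
    exists M.-1; rewrite prednK// xM andbT.
    have : M%:R <= M%:R * x by rewrite (le_trans _ h1)// ler_nat.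
    by apply: le_trans; rewrite ler_nat leq_pred.
  rewrite -(@bigcup_mkord _ _ I); exists j => //.
  rewrite /I /= in_itv /= -ler_distlC.
  have triw : `|tri (M%:R * x) - w j| <= 2 / N.
    rewrite -(ler_pM2l a0) -{1}(gtr0_norm a0) -normrM mulrBr /w.
    rewrite [a * (_ / a)]mulrC divfK; last by rewrite gt_eqF.
    have xj' : `|x - j%:R / M%:R| <= 2 / M%:R.
      rewrite -(ler_pM2l M0) -{1}(gtr0_norm M0) -normrM mulrBr.
      rewrite !(mulrCA M%:R) !divff ?(gt_eqF M0)// !mulr1 mulrC.
      by rewrite -natr1 in xj; rewrite ler_norml; apply/andP; split; lra.
    have := Hosc _ _ xj'; have := FH _ x01; rewrite Fxy -/N.
    have -> : a * (2 / N) = 2 * (a / N) by rewrite mulrCA.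
    set aN := a / N; set Hj := H (_ / _).
    rewrite !ler_norml => /andP[? ?] /andP[? ?]; apply/andP; split; lra.
  rewrite distrC -(ler_pM2l M0) -{1}(gtr0_norm M0) -normrM mulrBr.
  have -> : M%:R * c j = if odd j then j.+1%:R - w j else j%:R + w j.
    by rewrite /c mulrC divfK// gt_eqF.
  have -> : M%:R * r = 2 / N.
    by rewrite /r invfM mulrCA [M%:R * _]mulrCA divff ?gt_eqF// mulr1.
  apply: le_trans triw.
  rewrite (@tri_cell _ j) ?jx//; case: ifPn => _.
    by rewrite distrC addrAC.
  by rewrite opprD addrA.
apply: (le_trans (leb_bigsetU _ _)).
rewrite (eq_bigr (fun=> (2 * r)%:E)); last first.
  move=> i _; rewrite /I lebesgue_measure_itv /= lte_fin ifT; last by lra.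
  by rewrite -EFinD; congr EFin; lra.
rewrite sumEFin lee_fin sumr_const card_ord -mulr_natr /r.
rewrite [leLHS](_ : _ = 4 / N)//; field.
by rewrite !gt_eqF.
Qed.

Lemma ivt_same_side (F : R -> R) (u v y : R) : continuous F -> u <= v ->
  (forall x, u <= x <= v -> F x <> y) -> (F u < y) = (F v < y).
Proof.
move=> cF uv nF.
have cw : {within `[u, v], continuous F} by exact: continuous_subspaceT.
have := @IVT _ F u v y uv cw; case: (ltP (F u) y) => Fu; case: (ltP (F v) y) => Fv //.
  rewrite ge_min (ltW Fu) le_max Fv orbT => /(_ isT)[x].
  by rewrite in_itv /= => /nF.
rewrite ge_min (ltW Fv) orbT le_max Fu => /(_ isT)[x].
by rewrite in_itv /= => /nF.
Qed.

(** If [F] is on opposite sides of the level [F x0] at [x1] and [x2], it stays on these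
    sides up to [x0]. But arbitrarily close to [x0], on either side, the wave takes both
    its extreme values, which leaves no room for this. *)
Lemma sawtooth_no_crossing (F : R -> R) (x0 x1 x2 : R) : continuous F ->
  (forall n, sawtooth F n) -> 0 <= x1 -> x1 < x0 -> x0 < x2 -> x2 <= 1 ->
  (forall x, x1 <= x <= x2 -> F x = F x0 -> x = x0) ->
  (F x1 < F x0) = (F x2 < F x0).
Proof.
move=> cF sF x10 x1x x2x x21 iF; set y := F x0.
(* The term 4 makes the error [4 a / (n + 1)] smaller than [a]; the other one puts a
   full period of the wave on each side of [x0]. *)
pose k := Num.truncn (2 / Num.min (x0 - x1) (x2 - x0)); pose n := (4 + k)%N.
have [H [a [M [a0 nM Hosc FH]]]] := sF n.
have M0 : 0 < M%:R :> R by rewrite ltr0n (leq_ltn_trans _ nM).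
have M2 : 2 / M%:R < Num.min (x0 - x1) (x2 - x0).
  have m0 : 0 < Num.min (x0 - x1) (x2 - x0) by rewrite lt_min !subr_gt0 x1x.
  rewrite ltr_pdivrMr// mulrC -ltr_pdivrMr//.
  rewrite (lt_le_trans (truncnS_gt _))// ler_nat.
  by rewrite (leq_ltn_trans _ nM)// leq_addl.
move: M2; rewrite lt_min => /andP[M1 M2].
have aN : a / n.+1%:R <= a / 5.
  by rewrite ler_pM2l// lef_pV2 ?posrE ?ltr0n// ler_nat /n !addSn.
set d := 2 / M%:R in Hosc M1 M2.
have MdE : M%:R * d = 2 by rewrite /d mulrC divfK// gt_eqF.
have left_near s : s = 0 \/ s = 1 -> exists p, [/\ x1 <= p, p < x0 &
    `|F p - (H x0 + a * s)| <= 2 * (a / 5)].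
  move=> s01; have [p [p1 p2 ps]] := tri_extremal_left (M%:R * x0) s01.
  have pM : M%:R * (p / M%:R) = p by rewrite mulrC divfK// gt_eqF.
  have q1 : x0 - d <= p / M%:R by rewrite -(ler_pM2l M0) pM mulrBr MdE.
  have q2 : p / M%:R < x0 by rewrite -(ltr_pM2l M0) pM.
  exists (p / M%:R); split => //; first lra.
  have /FH : 0 <= p / M%:R <= 1 by lra.
  have /Hosc : `|p / M%:R - x0| <= d by rewrite ler_norml; lra.
  rewrite pM ps; set b := a / n.+1%:R in aN *.
  by rewrite !ler_norml => /andP[? ?] /andP[? ?]; apply/andP; split; lra.
have right_near s : s = 0 \/ s = 1 -> exists p, [/\ x0 < p, p <= x2 &
    `|F p - (H x0 + a * s)| <= 2 * (a / 5)].
  move=> s01; have [p [p1 p2 ps]] := tri_extremal_right (M%:R * x0) s01.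
  have pM : M%:R * (p / M%:R) = p by rewrite mulrC divfK// gt_eqF.
  have q1 : p / M%:R <= x0 + d by rewrite -(ler_pM2l M0) pM mulrDr MdE.
  have q2 : x0 < p / M%:R by rewrite -(ltr_pM2l M0) pM.
  exists (p / M%:R); split => //; first lra.
  have /FH : 0 <= p / M%:R <= 1 by lra.
  have /Hosc : `|p / M%:R - x0| <= d by rewrite ler_norml; lra.
  rewrite pM ps; set b := a / n.+1%:R in aN *.
  by rewrite !ler_norml => /andP[? ?] /andP[? ?]; apply/andP; split; lra.
have sl p : x1 <= p -> p < x0 -> (F p < y) = (F x1 < y).
  move=> xp px; apply/esym; apply: ivt_same_side => // x /andP[? ?] Fx.
  have : x = x0 by apply: iF Fx; lra.
  lra.
have sr p : x0 < p -> p <= x2 -> (F p < y) = (F x2 < y).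
  move=> xp px; apply: ivt_same_side => // x /andP[? ?] Fx.
  have : x = x0 by apply: iF Fx; lra.
  lra.
have [p0 [? ? +]] := left_near 0 (or_introl erefl).
have [p1 [? ? +]] := left_near 1 (or_intror erefl).
have [q0 [? ? +]] := right_near 0 (or_introl erefl).
have [q1 [? ? +]] := right_near 1 (or_intror erefl).
rewrite !ler_norml => /andP[q1l q1r] /andP[q0l q0r] /andP[p1l p1r] /andP[p0l p0r].
have := sl p0; have := sl p1; have := sr q0; have := sr q1.
case: (ltP (F x1) y) => h1; case: (ltP (F x2) y) => h2 // e1 e2 e3 e4.
  have : F p1 < y by rewrite e3.
  have : y <= F q0 by rewrite leNgt e2.
  lra.
have : F q1 < y by rewrite e1.
have : y <= F p0 by rewrite leNgt e4.
lra.
Qed.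

End sawtooth.

(** * Almost all levels are perfect on a translate of an equicontinuous family *)

Section perfect_levels.
Variable R : realType.

Lemma tri_mul_cts (M : nat) : continuous (fun x : R => tri (M%:R * x)).
Proof.
have ct : continuous (@tri R).
  move=> x; apply/cvgrPdist_le => /= e e0; near=> y.
  by rewrite (le_trans (tri_lipschitz _ _))//; near: y; exact: cvgr_dist_le.
move=> x; apply: (@cvg_comp _ _ _ (fun x => M%:R * x) (@tri R)); last exact: ct.
exact: mulrl_continuous.
Unshelve. all: by end_near. Qed.

Definition wave M : C01 R := restr (@tri_mul_cts M).

Lemma ext_wave M x : 0 <= x <= 1 -> ext (wave M) x = tri (M%:R * x).
Proof. exact: ext_restr. Qed.

(** A union of balls, hence open. The carrier [f + g0] is controlled simultaneously
    for all [f] in the equicontinuous family, so one [g] serves the whole family. *)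
Definition near_wave d n : set (C01 R) :=
  [set g | exists (g0 : C01 R) (a : R) (M : nat),
  [/\ 0 < a, (n < M)%N,
      forall f, equicts d f -> osc_le (2 / M%:R) (a / n.+1%:R) (f + g0) &
      `|g - (g0 + a *: wave M)| < a / n.+1%:R]].

Lemma near_wave_sawtooth d n g f : near_wave d n g -> equicts d f ->
  sawtooth (ext (f + g)) n.
Proof.
move=> [g0 [a [M [a0 nM oscM gM]]]] df.
exists (ext (f + g0)), a, M; split => //; first exact: oscM.
move=> x x01; rewrite -ext_wave// (le_trans _ (ltW gM))//.
have := ext_le_norm (g - (g0 + a *: wave M)) x.
rewrite !(extD, extN, extZ); apply: le_trans.
set a1 := (X in `|X| <= _); set a2 := (X in _ <= `|X|).
by have -> : a1 = a2 by rewrite /a1 /a2; ring.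
Qed.

Lemma open_near_wave d n : open (near_wave d n).
Proof.
rewrite openE => g [g0 [a [M [a0 nM oscM gM]]]].
apply/nbhs_ballP; exists (a / n.+1%:R - `|g - (g0 + a *: wave M)|) => /=.
  by rewrite subr_gt0.
move=> g1; rewrite -ball_normE /= => gg1; exists g0, a, M; split => //.
rewrite -(subrK g g1) -addrA (le_lt_trans (ler_normD _ _))//.
by rewrite -ltrBrDr distrC.
Qed.

(** Near any [g0] lies [g0 + a *: wave M]: the amplitude [a] is small but fixed, and [M]
    is then taken so large that the moduli of [g0] and of the family are negligible
    against [a]. *)
Lemma dense_near_wave d n : (forall m, 0 < d m) -> dense (near_wave d n).
Proof.
move=> d0 O [g0 Og0] oO.
have /nbhs_ballP[r /= r0 rO] : nbhs g0 O by exact: open_nbhs_nbhs.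
pose a := r / 2; have a0 : 0 < a by rewrite divr_gt0.
pose e := a / n.+1%:R; have e0 : 0 < e by rewrite divr_gt0.
have e2 : 0 < e / 2 by rewrite divr_gt0.
have [m gm] := heine g0 e2.
pose p := Num.truncn (2 / e); pose k := Num.truncn (2 / d p).
pose M := (n + k + m.+1.*2).+1.
have M0 : 0 < M%:R :> R by [].
have Md : 2 / M%:R <= d p.
  rewrite ler_pdivrMr// mulrC -ler_pdivrMr// (le_trans (ltW (truncnS_gt _)))//.
  by rewrite ler_nat /M ltnS -/k -addnA addnCA leq_addr.
have Mm : 2 / M%:R <= m.+1%:R^-1 :> R.
  rewrite ler_pdivrMr// mulrC ler_pdivlMr// -natrM ler_nat mul2n /M.
  by rewrite (leq_trans _ (leqnSn _))// leq_addl.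
have pe : (p.+1%:R^-1 : R) <= e / 2.
  rewrite -[e / 2]invrK lef_pV2 ?posrE ?invr_gt0// invf_div.
  exact/ltW/truncnS_gt.
exists (g0 + a *: wave M); split.
  apply: rO; rewrite -ball_normE /= opprD addNKr normrN.
  apply: (@le_lt_trans _ _ a); last by rewrite ltr_pdivrMr// ltr_pMr// ltr1n.
  apply: norm_le_ext => x x01; rewrite extZ ext_wave// normrM gtr0_norm//.
  by rewrite ger0_norm ?tri_ge0// ler_piMr ?tri_le1// ltW.
exists g0, a, M; split => //.
- by rewrite /M ltnS -addnA leq_addr.
- move=> f df x y xy; rewrite !extD.
  have := df p x y (le_trans xy Md); have := gm x y (le_trans xy Mm).
  move=> h1 h2; rewrite opprD addrACA (le_trans (ler_normD _ _))//.
  by rewrite -/e [leRHS]splitr lerD// (le_trans h2).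
- by rewrite subrr normr0.
Qed.

Lemma exists_sawtooth d : (forall m, 0 < d m) ->
  exists g : C01 R, forall f, equicts d f -> forall n, sawtooth (ext (f + g)) n.
Proof.
move=> d0.
have /Baire/(_ setT) : forall n, open (near_wave d n) /\ dense (near_wave d n).
  by move=> n; split; [exact: open_near_wave|exact: dense_near_wave].
case; [by exists 0|exact: openT|].
move=> g [_ gU]; exists g => f df n.
by apply: near_wave_sawtooth df; exact: (gU n I).
Qed.

(** The extremal value, attained, of [F] on a rational interval relative to [[0, 1]];
    the boolean selects minimum or maximum. There are countably many such values. *)
Definition extremal_level (F : R -> R) (q : rat * rat * bool) : set R :=
  [set y | exists x, [/\ 0 <= x <= 1, ratr q.1.1 < x < ratr q.1.2, F x = y &
    forall x', 0 <= x' <= 1 -> ratr q.1.1 < x' < ratr q.1.2 ->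
      if q.2 then y <= F x' else F x' <= y]].

Lemma extremal_level_unique F q y y' :
  extremal_level F q y -> extremal_level F q y' -> y = y'.
Proof.
case: q => -[q1 q2] b; move=> [x [x01 xq Fx xm]] [x' [x'01 x'q Fx' x'm]].
move: (xm x' x'01 x'q) (x'm x x01 xq); rewrite /= Fx Fx'.
by clear; case: b => h1 h2; apply/eqP; rewrite eq_le h1 h2.
Qed.

(** An isolated point of a level is either a local extremum or a point where the
    function crosses the level, and a sawtooth function has no isolated crossing. *)
Lemma not_perfect_extremal (f : C01 R) y : (forall n, sawtooth (ext f) n) ->
  ~ perfect_set (f @^-1` [set y]) -> exists q, extremal_level (ext f) q y.
Proof.
move=> sf /not_perfectP[x0 [x01 fx0 [e e0 ix]]]; have cf := @ext_cts R f.
have /rat_in_itvoo[q1 /[!in_itv]/= /andP[q1l q1r]] : x0 - e < x0 by lra.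
have /rat_in_itvoo[q2 /[!in_itv]/= /andP[q2l q2r]] : x0 < x0 + e by lra.
have [hmin|hmin] := pselect (forall x,
    0 <= x <= 1 -> ratr q1 < x < ratr q2 -> y <= ext f x).
  by exists (q1, q2, true), x0; split => //=; rewrite q1r.
have [hmax|hmax] := pselect (forall x,
    0 <= x <= 1 -> ratr q1 < x < ratr q2 -> ext f x <= y).
  by exists (q1, q2, false), x0; split => //=; rewrite q1r.
exfalso.
have [x1 [x1_01 x1q fx1]] : exists x,
    [/\ 0 <= x <= 1, ratr q1 < x < ratr q2 & ext f x < y].
  apply: contrapT => h; apply: hmin => x h1 h2; rewrite leNgt; apply/negP => h3.
  by apply: h; exists x.
have [x2 [x2_01 x2q fx2]] : exists x,
    [/\ 0 <= x <= 1, ratr q1 < x < ratr q2 & y < ext f x].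
  apply: contrapT => h; apply: hmax => x h1 h2; rewrite leNgt; apply/negP => h3.
  by apply: h; exists x.
have ix' x : 0 <= x <= 1 -> ratr q1 < x < ratr q2 -> ext f x = y -> x = x0.
  move=> h1 h2 h3; apply: ix => //; last by rewrite h3.
  by rewrite ltr_norml; lra.
have x1x0 : x1 != x0 by apply/eqP => h; move: fx1; rewrite h fx0 ltxx.
have x2x0 : x2 != x0 by apply/eqP => h; move: fx2; rewrite h fx0 ltxx.
have same u v : 0 <= u <= 1 -> ratr q1 < u < ratr q2 -> 0 <= v <= 1 ->
    ratr q1 < v < ratr q2 -> u <= v -> (v < x0 \/ x0 < u) ->
    (ext f u < y) = (ext f v < y).
  move=> u01 uq v01 vq uv side; apply: ivt_same_side => // x xuv fx.
  have xx0 : x = x0 by apply: ix' fx; lra.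
  by case: side; lra.
have cross u v : 0 <= u <= 1 -> ratr q1 < u < ratr q2 -> 0 <= v <= 1 ->
    ratr q1 < v < ratr q2 -> u < x0 -> x0 < v -> (ext f u < y) = (ext f v < y).
  move=> /andP[u0 _] uq /andP[_ v1] vq ux xv; rewrite -fx0.
  apply: sawtooth_no_crossing => // x xuv; rewrite fx0 => fx.
  by apply: ix' fx; lra.
suff : (ext f x1 < y) = (ext f x2 < y) by rewrite fx1 ltNge (ltW fx2).
move: x1x0 x2x0; rewrite !neq_lt => /orP[h1|h1] /orP[h2|h2].
- have [h|/ltW h] := leP x1 x2; first by apply: same => //; left.
  by apply/esym; apply: same => //; left.
- exact: cross.
- by apply/esym; exact: cross.
- have [h|/ltW h] := leP x1 x2; first by apply: same => //; right.
  by apply/esym; apply: same => //; right.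
Qed.

Lemma sawtooth_perfect_ae (f : C01 R) : (forall n, sawtooth (ext f) n) ->
  occupation_measure f [set y | ~ perfect_set (f @^-1` [set y])] = 0%E.
Proof.
move=> sf; rewrite occupation_measureE; apply/eqP.
rewrite eq_le leb_ge0 andbT.
pose G q := [set x : R | 0 <= x <= 1 /\ extremal_level (ext f) q (ext f x)].
rewrite -(@null_countable_bigcup R _ G).
  apply: leb_mono => x [x01 /(not_perfect_extremal sf)[q qx]].
  by exists q.
move=> q; have [[y qy]|nq] := pselect (exists y, extremal_level (ext f) q y).
  apply: (@leb_small R _ 4) => n; apply: le_trans (sawtooth_level y (sf n)).
  apply: leb_mono => x [x01 qx]; split => //.
  exact: extremal_level_unique qx qy.
suff -> : G q = set0 by rewrite measure0.
by apply/seteqP; split => // x [_ qx]; apply: nq; exists (ext f x).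
Qed.

(** A translate of a set of positive measure consists of sawtooth functions, so it lies
    in every set that contains the complement of [A]. *)
Lemma not_prevalent_sawtooth (A : set (C01 R)) :
  (forall f, (forall n, sawtooth (ext f) n) -> ~ A f) -> ~ prevalent A.
Proof.
move=> sA [B [mu [mB AB muB]]].
have [d [d0 mud]] := probability_equicts mu.
have [g gd] := exists_sawtooth d0.
have mK := measurable_equicts d.
move: mud; rewrite ltNge => /negP; apply; rewrite -(muB (- g)).
have KB : equicts d `<=` translate B (- g).
  move=> f df; exists (f + g); last by rewrite addrK.
  by apply: AB; apply: sA; exact: gd.
apply: (@le_measure _ _ _ mu _ _ _ _ KB); rewrite inE//.
have -> : translate B (- g) = (fun f => f + g) @^-1` B.
  apply/seteqP; split => [_ [h Bh <-]|f Bf]; first by rewrite /preimage /= subrK.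
  by exists (f + g) => //; rewrite addrK.
have cg : continuous (fun f : C01 R => f + g).
  move=> f; apply: (@cvgD R (C01 R) (C01 R) (nbhs f) _ id (cst g) f g).
    exact: cvg_id.
  exact: cvg_cst.
suff mg : measurable_fun setT ((fun f => f + g) : borel (C01 R) -> borel (C01 R)).
  by rewrite -[X in measurable X]setTI; exact: mg.
apply: (@measurability _ _ (borel (C01 R)) (borel (C01 R)) setT _ open) => //.
move=> _ [U oU <-]; rewrite setTI; apply: borel_open.
by apply: open_comp => // ? _; exact: cg.
Qed.

End perfect_levels.

(** * A steep devil's staircase *)

Section summable_below.
Variable R : realType.

(** Take [l k] to be [2^-(k+1)] times the product of the [min 1 (d j)], [j <= k]. *)
Lemma summable_below (d : nat -> R) : (forall k, 0 < d k) ->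
  exists l : nat -> R, (forall k, 0 < l k) /\
    forall m n, \sum_(k < n | (m <= k)%N) l k <= d m.
Proof.
move=> d0; pose p k := \prod_(j < k.+1) Num.min 1 (d j).
have min0 j : 0 < Num.min 1 (d j) by rewrite lt_min ltr01 d0.
have p0 k : 0 < p k by apply: prodr_gt0.
have pd k : p k <= d k.
  rewrite /p big_ord_recr /= (@le_trans _ _ (Num.min 1 (d k)))//.
    rewrite ler_piMl ?(ltW (min0 k))//.
    have : forall j : 'I_k, xpredT j -> 0 <= Num.min 1 (d j) <= 1.
      by move=> j _; rewrite (ltW (min0 j)) ge_min lexx.
    by move=> /prodr_ile1.
  by rewrite ge_min lexx orbT.
have pS m i : p (m + i)%N <= p m.
  elim: i => [|i IHi]; first by rewrite addn0.
  apply: le_trans IHi; rewrite addnS /p big_ord_recr /= ler_piMr//.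
    by rewrite (ltW (p0 (m + i)%N)).
  by rewrite ge_min lexx.
exists (fun k => p k / 2 ^+ k.+1); split.
  by move=> k; rewrite divr_gt0// exprn_gt0.
move=> m n; apply: le_trans (pd m).
apply: (@le_trans _ _ (\sum_(k < n) p m / 2 ^+ k.+1)).
  rewrite big_mkcond; apply: ler_sum => k _; case: ifPn => [mk|_].
    by rewrite ler_pM2r ?invr_gt0 ?exprn_gt0// -(subnKC mk).
  by rewrite divr_ge0// ltW.
have -> : \sum_(k < n) p m / 2 ^+ k.+1 = p m - p m / 2 ^+ n.
  elim: n => [|n IHn]; first by rewrite big_ord0 expr0 divr1 subrr.
  rewrite big_ord_recr /= IHn exprS; field.
  by rewrite expf_neq0.
by rewrite lerBlDr lerDl divr_ge0// ltW// ?exprn_gt0.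
Qed.

End summable_below.

Section staircase.
Variable R : realType.
Variables (q l d : nat -> R).
Hypothesis q_dense : forall a b, a < b -> exists k, a < q k < b.
Hypothesis l_gt0 : forall k, 0 < l k.
Hypothesis l_tail : forall m n, \sum_(k < n | (m <= k)%N) l k <= d m.
Hypothesis d_small : forall e, 0 < e -> exists m, d m < e.

Let psi (n : nat) (y : R) := \sum_(k < n | q k < y) l k.

(** A pure jump function with a jump [l k] at each [q k]. Its generalized inverse is
    the staircase. *)
Definition jump_sum (y : R) : R := sup (range (psi^~ y)).
Local Notation X := jump_sum.

Let psi_le n y : psi n y <= X y.
Proof.
apply: ub_le_sup; last by exists n.
exists (d 0%N) => _ [m _ <-]; apply: le_trans (l_tail 0 m).
rewrite /psi big_mkcond [leRHS]big_mkcond /=; apply: ler_sum => k _.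
by case: ifP => //; rewrite ltW.
Qed.

Let X_le y c : (forall n, psi n y <= c) -> X y <= c.
Proof. by move=> h; apply: ge_sup; [exists (psi 0 y); exists 0%N|move=> _ [n _ <-]]. Qed.

Lemma jump_sum_ge k y y' : y <= q k -> q k < y' -> X y + l k <= X y'.
Proof.
move=> yk ky'; rewrite -lerBrDr; apply: X_le => n; rewrite lerBrDr.
apply: (le_trans _ (psi_le (maxn n k.+1) y')).
have kM : (k < maxn n k.+1)%N by rewrite leq_max leqnn orbT.
rewrite /psi [leRHS](bigD1 (Ordinal kM)) //= [leLHS]addrC lerD2l.
rewrite (big_ord_widen_cond (maxn n k.+1) (fun i => q i < y) l) ?leq_maxl//.
rewrite big_mkcond [leRHS]big_mkcond /=; apply: ler_sum => i _.
have [/andP[qi _]|_] := ifP; last by case: ifP => // _; rewrite ltW.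
rewrite ifT// (lt_trans (lt_le_trans qi yk) ky')/=.
by apply/eqP => ik; move: qi; rewrite ik /= ltNge yk.
Qed.

Lemma le_jump_sum y y' : y <= y' -> X y <= X y'.
Proof.
rewrite le_eqVlt => /orP[/eqP->//|yy'].
have [k /andP[h1 h2]] := q_dense yy'.
by rewrite (le_trans _ (jump_sum_ge (ltW h1) h2))// lerDl ltW.
Qed.

Lemma lt_jump_sum y y' : y < y' -> X y < X y'.
Proof.
move=> yy'; have [k /andP[h1 h2]] := q_dense yy'.
by rewrite (lt_le_trans _ (jump_sum_ge (ltW h1) h2))// ltrDl.
Qed.

(** If only jumps of index at least [m] lie between [y] and [y'], the increment is a
    partial tail of the series. *)
Lemma jump_sum_le m y y' : (forall j, (j < m)%N -> ~ (y <= q j < y')) ->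
  X y' <= X y + d m.
Proof.
move=> h; apply: X_le => n; apply: (le_trans _ (lerD (psi_le n y) (l_tail m n))).
rewrite /psi big_mkcond [X in _ <= X + _]big_mkcond [X in _ <= _ + X]big_mkcond.
rewrite -big_split /=; apply: ler_sum => i _.
have l0 := ltW (l_gt0 i).
case: ifPn => qy'; case: ifPn => qy; case: ifPn => mi;
  rewrite ?addr0 ?add0r ?lerDl ?addr_ge0//.
by exfalso; apply: (h i); rewrite ?ltnNge// qy' leNgt qy.
Qed.

Let A (x : R) := [set y : R | y <= 1 /\ (y <= 0 \/ X y <= x)].
(** The generalized inverse of [jump_sum], clipped to [[0, 1]]: a devil's staircase,
    constant equal to [q k] on an interval of length [l k] when [q k] is in [[0, 1]]. *)
Definition staircase (x : R) : R := sup (A x).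
Local Notation G := staircase.

Let A_ub x : has_ubound (A x). Proof. by exists 1 => y []. Qed.
Let A0 x : A x 0. Proof. by split; [exact: ler01|left]. Qed.

Lemma staircase_ge0 x : 0 <= G x.
Proof. by apply: ub_le_sup. Qed.

Lemma staircase_le1 x : G x <= 1.
Proof. by apply: ge_sup; [exists 0|move=> y []]. Qed.

Let lt_G x y : 0 <= y -> y < G x -> exists2 y', y < y' & X y' <= x.
Proof.
move=> y0 yG; apply: contrapT => h.
move: yG; apply/negP; rewrite -leNgt; apply: ge_sup; first by exists 0.
move=> z [_ [z0|zx]]; first exact: le_trans z0 y0.
by rewrite leNgt; apply/negP => yz; apply: h; exists z.
Qed.

Let G_lt x y : G x < y -> y <= 1 -> x < X y.
Proof.
move=> Gy y1; rewrite ltNge; apply/negP => xy; move: Gy; apply/negP.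
by rewrite -leNgt; apply: ub_le_sup => //; split => //; right.
Qed.

Lemma staircaseK y : 0 <= y <= 1 -> G (X y) = y.
Proof.
move=> /andP[y0 y1]; apply/eqP; rewrite eq_le; apply/andP; split; last first.
  by apply: ub_le_sup => //; split => //; right.
apply: ge_sup; first by exists 0.
move=> z [_ [z0|zx]]; first exact: le_trans z0 y0.
by rewrite leNgt; apply/negP => /lt_jump_sum; rewrite ltNge zx.
Qed.

Lemma le_staircase x x' : x <= x' -> G x <= G x'.
Proof.
move=> xx'; apply: ge_sup; first by exists 0.
move=> y [y1 h]; apply: ub_le_sup => //; split => //.
by case: h => [->|h]; [left|right; exact: le_trans xx'].
Qed.

Lemma staircase0 x : x <= X 0 -> G x = 0.
Proof.
move=> x0; apply/eqP; rewrite eq_le staircase_ge0 andbT.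
by rewrite -[leRHS](@staircaseK 0) ?lexx ?ler01//; exact: le_staircase.
Qed.

Lemma staircase1 x : X 1 <= x -> G x = 1.
Proof.
move=> x0; apply/eqP; rewrite eq_le staircase_le1/=.
by rewrite -[leLHS](@staircaseK 1) ?lexx ?ler01//; exact: le_staircase.
Qed.

Let G_gap x x' k : G x < q k -> q k < G x' -> x + l k <= x'.
Proof.
move=> h1 h2.
have qk0 : 0 <= q k by rewrite (le_trans (staircase_ge0 x))// ltW.
have qk1 : q k <= 1 by rewrite (le_trans _ (staircase_le1 x'))// ltW.
have [y qy yx'] := lt_G qk0 h2.
have /ltW := G_lt h1 qk1; rewrite -(lerD2r (l k)) => /le_trans; apply.
by rewrite (le_trans (jump_sum_ge _ qy)).
Qed.

(** To climb strictly past some [q k], the staircase must cross its step, of length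
    [l k]; as the [q k] are dense, this bounds the variation near each point. *)
Lemma staircase_cts : continuous G.
Proof.
move=> x; apply/cvgrPdist_lt => /= e e0.
have [k /andP[k1 k2]] : exists k, G x < q k < G x + e by apply: q_dense; rewrite ltrDl.
have [j /andP[j1 j2]] : exists j, G x - e < q j < G x.
  by apply: q_dense; rewrite ltrBlDr ltrDl.
apply/nbhs_ballP; exists (Num.min (l k) (l j)) => /=; first by rewrite lt_min !l_gt0.
move=> x'; rewrite /ball /= lt_min => /andP[h1 h2].
have h3 : G x' <= q k.
  rewrite leNgt; apply/negP => /(G_gap k1).
  by have := ler_norm (x' - x); rewrite distrC; lra.
have h4 : q j <= G x'.
  rewrite leNgt; apply/negP => h; have := G_gap h j2.
  by have := ler_norm (x - x'); lra.
by rewrite ltr_norml; apply/andP; split; lra.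
Qed.

Let margin m al be : (forall j, (j < m)%N -> ~ (al <= q j <= be)) ->
  exists2 e, 0 < e & forall j, (j < m)%N -> ~ (al - e <= q j <= be + e).
Proof.
elim: m => [|m IHm] h; first by exists 1.
have [|e e0 he] := IHm; first by move=> j jm; apply: h; rewrite ltnS ltnW.
have hm := h m (ltnSn m).
pose e1 := if q m < al then (al - q m) / 2 else (q m - be) / 2.
have e10 : 0 < e1 /\ ~ (al - e1 <= q m <= be + e1).
  rewrite /e1; case: (ltP (q m) al) => qa; first by split; [lra|move=> /andP[? ?]; lra].
  have : be < q m by rewrite ltNge; apply/negP => qb; apply: hm; rewrite qa.
  by move=> ?; split; [lra|move=> /andP[? ?]; lra].
exists (Num.min e e1); first by rewrite lt_min e0 e10.1.
have m1 : Num.min e e1 <= e by rewrite ge_min lexx.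
have m2 : Num.min e e1 <= e1 by rewrite ge_min lexx orbT.
move=> j; rewrite ltnS leq_eqVlt => /orP[/eqP->|jm] /andP[h1 h2].
  by apply: e10.2; apply/andP; split; lra.
by apply: (he j jm); apply/andP; split; lra.
Qed.

Let bracket m x x' : X 0 <= x -> x <= x' -> x' <= X 1 ->
  (forall j, (j < m)%N -> ~ (G x <= q j <= G x')) ->
  exists lo, [/\ lo <= x, x' <= lo + d m &
    forall z, G x <= z <= G x' -> lo <= X z <= lo + d m].
Proof.
move=> x0 xx' x'1 /margin[e e0 he].
pose y := G x - e; pose y' := G x' + e.
have yx : X y <= x.
  have [y_ge0|y_lt0] := leP 0 y; last by rewrite (le_trans _ x0)// le_jump_sum// ltW.
  have [|z yz zx] := @lt_G x y y_ge0; first by rewrite /y; lra.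
  by rewrite (le_trans _ zx)// le_jump_sum// ltW.
have xy' : x' <= X y'.
  have [y1|y1] := leP y' 1; last by rewrite (le_trans x'1)// le_jump_sum// ltW.
  by apply/ltW/G_lt => //; rewrite /y'; lra.
have X2 : X y' <= X y + d m.
  by apply: jump_sum_le => j jm /andP[h1 h2]; apply: (he j jm); rewrite h1 ltW.
exists (X y); split => //; first exact: le_trans xy' X2.
move=> z /andP[h1 h2]; rewrite le_jump_sum/=; last by rewrite /y; lra.
by rewrite (le_trans _ X2)// le_jump_sum// /y'; lra.
Qed.

(** Let [k] be the least index with [q k] among the values taken between [x] and [x'].
    Only jumps of index at least [k] contribute to [x' - x], so this length is at most
    [d k]; the abscissa [X (q k)] of that jump is caught in the same bracket. *)
Lemma staircase_steep x x' : X 0 <= x -> x < x' -> x' <= X 1 ->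
  exists k, [/\ G x <= G (X (q k)) <= G x', `|x - X (q k)| <= d k &
                `|x' - X (q k)| <= d k].
Proof.
move=> x0 xx' x'1.
have [j0 j0P] : exists j, G x <= q j <= G x'.
  apply: contrapT => h; have xx'0 : 0 < x' - x by rewrite subr_gt0.
  have [m dm] := d_small xx'0.
  have [|lo [h1 h2 _]] := @bracket m x x' x0 (ltW xx') x'1.
    by move=> j _ hj; apply: h; exists j.
  lra.
have ex : exists j, (fun j => G x <= q j <= G x') j by exists j0.
case: (ex_minnP ex) => k kP kmin; exists k.
have [|lo [h1 h2 /(_ _ kP) /andP[h3 h4]]] := @bracket k x x' x0 (ltW xx') x'1.
  by move=> j jk /kmin; rewrite leqNgt jk.
rewrite staircaseK ?kP; last first.
  move: kP => /andP[h5 h6]; rewrite (le_trans (staircase_ge0 x))//.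
  by rewrite (le_trans h6 (staircase_le1 x')).
by split => //; rewrite ler_norml; apply/andP; split; lra.
Qed.

End staircase.

(** * Levels attained exactly once *)

Section good_levels.
Variable R : realType.

(** [d] prescribes how steep the staircase is: its role is to make the oscillation of
    given functions over length [d k] negligible. The centres [a k] are fixed in advance, so
    that neighbourhoods of their images can be discarded. *)
Lemma exists_staircase (c : R) (d : nat -> R) : (forall k, 0 < d k) ->
  exists (G : R -> R) (a : nat -> R) (s : R),
  [/\ continuous G, 0 <= s <= d 0%N, G c = 0, G (c + s) = 1 &
    forall x x', c <= x -> x < x' -> x' <= c + s ->
      exists k, [/\ G x <= G (a k) <= G x', `|x - a k| <= d k &
                    `|x' - a k| <= d k]].
Proof.
move=> d0; pose q k : R := ratr (odflt 0 (@unpickle rat k)).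
have qd x y : x < y -> exists k, x < q k < y.
  move=> /rat_in_itvoo[r]; rewrite in_itv /= => rxy.
  by exists (pickle r); rewrite /q pickleK.
(* The second term makes [d' k] tend to 0. *)
pose d' k := Num.min (d k) k.+1%:R^-1.
have d'0 k : 0 < d' k by rewrite lt_min d0 /=.
have d'd k : d' k <= d k by rewrite ge_min lexx.
have [l [l0 ld]] := summable_below d'0.
have d's (e : R) : 0 < e -> exists m, d' m < e.
  move=> e0; exists (Num.truncn e^-1).
  rewrite (@le_lt_trans _ _ (Num.truncn e^-1).+1%:R^-1)//.
    by rewrite ge_min lexx orbT.
  by rewrite invf_plt ?posrE// truncnS_gt.
pose X := jump_sum q l.
pose S := X 1 - X 0.
exists (fun x => staircase q l (x - c + X 0)), (fun k => X (q k) - X 0 + c), S.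
have addK z : z - X 0 + c - c + X 0 = z by lra.
split.
- move=> x; apply: (@continuous_comp _ _ _ (fun x => x - c + X 0) (staircase q l)).
    by apply: cvgD; [apply: cvgB; [exact: cvg_id|exact: cvg_cst]|exact: cvg_cst].
  exact: (staircase_cts qd l0 ld).
- rewrite /S subr_ge0 (le_jump_sum qd l0 ld)//=.
  have : X 1 <= X 0 + d' 0%N by apply: (jump_sum_le l0 ld).
  by have := d'd 0%N; lra.
- by rewrite subrr add0r (staircase0 qd l0 ld).
- by rewrite /= (staircase1 qd l0 ld)// -/X /S; lra.
- move=> x x' cx xx' x's.
  have [| | |k [h1 h2 h3]] := @staircase_steep _ q l d' qd l0 ld d's
    (x - c + X 0) (x' - c + X 0).
  + by rewrite -/X; lra.
  + by lra.
  + by rewrite -/X; move: x's; rewrite /S; lra.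
  exists k; rewrite addK; split => //.
  + rewrite (le_trans _ (d'd k))//; rewrite /=.
    by have -> : x - (X (q k) - X 0 + c) = x - c + X 0 - X (q k) by lra.
  + rewrite (le_trans _ (d'd k))//; rewrite /=.
    by have -> : x' - (X (q k) - X 0 + c) = x' - c + X 0 - X (q k) by lra.
Qed.

(** Let [F = ext f + G], with [G] rising from [0] to [1] on [[c, c + s]]. If two points
    of it are on the same level [y] of [F], then by steepness both are so close to some
    [a k] that [f] differs by at most [eps k] between [a k] and either of them; as [F]
    agrees at both points, [G] differs by at most [2 * eps k] between them, and so [y]
    is within [3 * eps k] of [F (a k)]. As the [eps k] sum to [1/12], the values to
    discard have measure at most [1/2], while [F] covers an interval of length at
    least [23/24]. Each remaining level is attained exactly once. *)
Lemma exists_isolating (c r : R) (d : nat -> R) : (forall k, 0 < d k) -> 0 < r ->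
  exists (G : R -> R) (s : R), [/\ continuous G, 0 <= s <= r &
    forall f, equicts d f -> exists W : set R,
    [/\ measurable W, (0 < lebesgue_measure W)%E &
      forall y, W y -> exists x0, [/\ c < x0 < c + s, ext f x0 + G x0 = y &
        forall x, c < x < c + s -> ext f x + G x = y -> x = x0]]].
Proof.
move=> d0 r0.
pose eps (k : nat) : R := 12^-1 / (2 ^ k.+1)%:R.
have eps0 k : 0 < eps k by rewrite divr_gt0// ltr0n expn_gt0.
pose n k := Num.truncn (eps k)^-1.
have neps k : (n k).+1%:R^-1 <= eps k.
  by rewrite invf_ple ?posrE// ltW// truncnS_gt.
pose d' k := Num.min (d (n k)) r.
have d'0 k : 0 < d' k by rewrite lt_min d0.
have [G [a [s [cG /andP[s0 sd] G0 G1 steep]]]] := exists_staircase c d'0.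
exists G, s; split => //; first by rewrite s0 (le_trans sd)// ge_min lexx orbT.
move=> f df; pose F x := ext f x + G x.
have fd k x y : `|x - y| <= d' k -> `|ext f x - ext f y| <= eps k.
  move=> xy; apply: (le_trans _ (neps k)); apply: df; apply: (le_trans xy).
  by rewrite ge_min lexx.
pose I k := `[F (a k) - 3 * eps k, F (a k) + 3 * eps k]%classic.
pose J : set R := `]F c, F (c + s)[%classic; pose W := J `\` \bigcup_k I k.
have mI : measurable (\bigcup_k I k) by apply: bigcupT_measurable => k; exact: measurable_itv.
have mJ : measurable J by exact: measurable_itv.
have mW : measurable W by exact: measurableD.
exists W; split => //.
- have leI : (lebesgue_measure (\bigcup_k I k) <= 2^-1%:E)%E.
    apply: (le_trans (leb_bigcup _)).
    apply: (le_trans _ (@epsilon_trick0 R 2^-1 xpredT _)); last by rewrite invr_ge0.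
    apply: lee_nneseries => [k _ _|k _]; first exact: leb_ge0.
    rewrite /I lebesgue_measure_itv /= lte_fin; have ek := eps0 k; rewrite ifT; last by lra.
    rewrite -EFinD lee_fin (_ : 2^-1 / _ = 6 * eps k); first lra.
    by rewrite /eps mulrA; congr (_ / _); lra.
  have leJ : ((23 / 24)%:E <= lebesgue_measure J)%E.
    have := fd 0%N (c + s) c; rewrite addrC addKr ger0_norm// => /(_ sd).
    rewrite ler_norml /eps expn1 => /andP[h1 h2].
    rewrite /J lebesgue_measure_itv /= lte_fin /F G0 G1 ifT; last by lra.
    by rewrite -EFinD lee_fin; lra.
  have : (lebesgue_measure J <=
     lebesgue_measure W + lebesgue_measure (\bigcup_k I k))%E.
    rewrite -measureU//; last first.
    + by rewrite /W setDE -setIA setICl setI0.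
    apply: leb_mono => x Jx.
    by have [?|?] := pselect ((\bigcup_k I k) x); [right|left].
  rewrite lt_neqAle leb_ge0 andbT => h; apply/eqP => W0.
  move: h; rewrite -W0 add0e => /(le_trans leJ) /le_trans /(_ leI).
  by rewrite lee_fin; lra.
- move=> y [+ nI]; rewrite /J /= in_itv /= => /andP[y1 y2].
  have cF : continuous F by move=> x; apply: cvgD; [exact: ext_cts|exact: cG].
  have uniq x x' : c <= x -> x < x' -> x' <= c + s -> F x = y -> F x' = y -> False.
    move=> cx xx' x's Fx Fx'; have [k [/andP[g1 g2] /fd h1 /fd h2]] := steep _ _ cx xx' x's.
    apply: nI; exists k => //; rewrite /I /= in_itv /=.
    move: h1 h2 Fx Fx'; rewrite /F !ler_norml => /andP[? ?] /andP[? ?] ? ?.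
    by apply/andP; split; lra.
  have ccs : c <= c + s by rewrite lerDl.
  have [x0] := @IVT _ F c (c + s) y ccs (continuous_subspaceT cF)
    (ltac:(by rewrite ge_min (ltW y1) le_max (ltW y2) orbT)).
  rewrite in_itv /= => /andP[x1 x2] Fx0; exists x0; split => //.
  + by rewrite !lt_neqAle x1 x2 !andbT; apply/andP; split; apply/eqP => h;
      move: Fx0 y1 y2; rewrite ?h -?h => -> ; rewrite ltxx.
  + move=> x /andP[x3 x4] Fx; apply/eqP; rewrite eq_le !leNgt.
    apply/andP; split; apply/negP => h.
      by apply: (uniq x0 x) => //; exact: ltW.
    by apply: (uniq x x0) => //; exact: ltW.
Qed.

End good_levels.

(** * Product measures *)

Section sections.
Context d1 d2 (T1 : measurableType d1) (T2 : measurableType d2) (R : realType).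
Variables (m1 : {sigma_finite_measure set T1 -> \bar R})
          (m2 : {sigma_finite_measure set T2 -> \bar R}).

(** Tonelli's theorem for the indicator function of [A]. *)
Lemma ae_null_sections (A : set (T1 * T2)) : measurable A ->
  {ae m2, forall y, m1 (ysection A y) = 0%E} ->
  {ae m1, forall x, m2 (xsection A x) = 0%E}.
Proof.
move=> mA A0; pose phi (x : T1) : \bar R := m2 (xsection A x).
have mphi : measurable_fun setT phi by exact: measurable_fun_xsection.
suff : ae_eq m1 setT phi (cst 0%E) by apply: filterS => x /(_ I).
apply/ae_eq_integral_abs => //.
have := indic_fubini_tonelli m1 m2 mA.
rewrite indic_fubini_tonelli_FE// indic_fubini_tonelli_GE// => FG.
rewrite (eq_integral phi); last first.
  by move=> x _; rewrite gee0_abs// measure_ge0.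
rewrite [LHS]FG (ae_eq_integral (cst 0%E))//.
- by rewrite integral0.
- exact: measurable_fun_ysection.
- by apply: filterS A0 => y /= ->.
Qed.

End sections.

Section reflect.
Variable R : realType.

Lemma lebesgue_measure_reflect (w : R) (A : set R) : measurable A ->
  lebesgue_measure [set t | A (w - t)] = lebesgue_measure A.
Proof.
move=> mA; pose r : measurableTypeR R -> measurableTypeR R := fun t => w - t.
rewrite -[LHS]/(pushforward lebesgue_measure r A).
have mw : measurable_fun setT r.
  by apply: measurable_funB.
apply/esym/lebesgue_measure_unique => //= _ [[a b]] _ <-.
rewrite /pushforward.
have -> : r @^-1` `]a, b]%classic = `[w - b, w - a[%classic.
  by apply/seteqP; split => t;
    rewrite /r /= !in_itv /= => /andP[? ?]; apply/andP; split; lra.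
rewrite !lebesgue_measure_itv/= !lte_fin ltrD2l ltrN2.
by case: ifP => // _; rewrite -!EFinB; congr EFin; lra.
Qed.

End reflect.

Section product_measurability.
Variable R : realType.

(** The Borel sets of [G] times a second countable space are generated by boxes, even
    when [G] is not separable: an open [U] is the union over rational intervals [I] of
    [V * I], with [V] the interior of the set of all [f] such that [{f} * I] lies in [U]. *)
Lemma open_prod_measurable (G : completeNormedModType R) (U : set (G * R)) :
  open U -> measurable (U : set (borel G * measurableTypeR R)).
Proof.
move=> oU.
pose V (q : rat * rat) : set G :=
  interior [set f : G | forall t : R, ratr q.1 < t < ratr q.2 -> U (f, t)].
pose I (q : rat * rat) : set R := `]ratr q.1, ratr q.2[%classic.
have -> : U = \bigcup_q (V q `*` I q).
  apply/seteqP; split => [[f t] Uft|[f t] [q _ [/= Vf]]]; last first.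
    by rewrite /I /= in_itv /=; exact: (interior_subset Vf).
  have : nbhs (f, t) U by exact: open_nbhs_nbhs.
  move=> [[A B]] /= [nA /nbhs_ballP[e /= e0 eB]] AB.
  have /rat_in_itvoo[q1 /[!in_itv]/= /andP[q1l q1r]] : t - e < t by lra.
  have /rat_in_itvoo[q2 /[!in_itv]/= /andP[q2l q2r]] : t < t + e by lra.
  exists (q1, q2) => //; split; last by rewrite /I /= in_itv /= q1r.
  apply: filterS nA => f' Af' t' /= /andP[t1 t2]; apply: AB; split => //=.
  by apply: eB; rewrite /ball /= ltr_norml; apply/andP; split; lra.
apply: countable_bigcupT_measurable => [|q]; first exact: countableP.
apply: measurableX; last exact: measurable_itv.
by apply: borel_open; exact: open_interior.
Qed.

Lemma measurable_affine_path (g h : C01 R) (B : set (C01 R)) :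
  measurable (B : set (borel (C01 R))) ->
  measurable ([set p | B (p.1 + (g + p.2 *: h))] : set (borel (C01 R) * measurableTypeR R)).
Proof.
move=> mB.
pose phi (p : C01 R * R) := p.1 + (g + p.2 *: h).
have cphi : continuous phi.
  move=> p.
  apply: (@cvgD R (C01 R) _ (nbhs p) _ fst (fun p => g + p.2 *: h) p.1 (g + p.2 *: h)).
    exact: cvg_fst.
  apply: (@cvgD R (C01 R) _ (nbhs p) _ (cst g) (fun p => p.2 *: h) g (p.2 *: h)).
    exact: cvg_cst.
  apply: cvgZr_tmp; exact: cvg_snd.
suff mphi : measurable_fun setT (phi : borel (C01 R) * measurableTypeR R -> borel (C01 R)).
  by rewrite -[X in measurable X]setTI; exact: mphi.
apply: (@measurability _ _ _ (borel (C01 R)) setT _ open) => //.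
move=> _ [U oU <-]; rewrite setTI; apply: open_prod_measurable.
by apply: open_comp => // ? _; exact: cphi.
Qed.

End product_measurability.

(** * Positive occupation of levels with an isolated point *)

Section not_shy.
Variable R : realType.

(** An occupation measure, however singular, charges a set of positive measure for many
    of its translates: by Tonelli's theorem in [(x, t)], the integral over [t] of the measure
    considered is half the measure of [W]. *)
Lemma occupation_meets (phi : R -> R) (W : set R) : continuous phi ->
  measurable W -> (0 < lebesgue_measure W)%E ->
  ~ {ae @lebesgue_measure R, forall t,
       lebesgue_measure [set x | 0 <= x <= 2^-1 /\ W (phi x - t)] = 0%E}.
Proof.
move=> cphi mW W0 H.
pose E : set (measurableTypeR R * measurableTypeR R) :=
  [set p | 0 <= p.1 <= 2^-1 /\ W (phi p.1 - p.2)].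
have mE : measurable E.
  have -> : E = fst @^-1` `[0, 2^-1]%classic `&` (fun p => phi p.1 - p.2) @^-1` W.
    by apply/seteqP; split => p /=; rewrite in_itv.
  have mphi : measurable_fun setT (phi : measurableTypeR R -> measurableTypeR R).
    exact: continuous_measurable_fun.
  apply: measurableI.
    by rewrite -[X in measurable X]setTI; apply: measurable_fst => //; exact: measurable_itv.
  rewrite -[X in measurable X]setTI.
  have : measurable_fun setT ((fun p => phi p.1 - p.2) :
      measurableTypeR R * measurableTypeR R -> measurableTypeR R).
    by apply: measurable_funB; [exact: measurableT_comp|exact: measurable_snd].
  exact.
have [Z [mZ Z0 EZ]] : {ae @lebesgue_measure R, forall x, lebesgue_measure (xsection E x) = 0%E}.
  apply: (ae_null_sections (m2 := lebesgue_measure) mE).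
  move: H => [Y [mY Y0 HY]]; exists Y; split => // t nt; apply: HY => /= Ht.
  apply: nt; rewrite -Ht; congr (lebesgue_measure _).
  by apply/seteqP; split => x; [move/ysectionP|move=> Ex; apply/ysectionP].
pose J : set R := `[0, 2^-1]%classic.
have : (lebesgue_measure J <= lebesgue_measure Z)%E.
  apply: leb_mono => x; rewrite /J /= in_itv /= => x01; apply: EZ => /= xE.
  move: W0; rewrite -(lebesgue_measure_reflect (phi x) mW) lt_neqAle => /andP[/eqP + _].
  apply; rewrite -[LHS]xE; congr (lebesgue_measure _).
  apply/seteqP; split => t; first by move/xsectionP => -[].
  by move=> Wt; apply/xsectionP.
rewrite Z0 /J lebesgue_measure_itv /= lte_fin ifT; last by lra.
by rewrite -EFinB lee_fin; lra.
Qed.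

(** Multiples of the ramp shift the graph vertically over [[3/4, 1]] and leave it
    untouched over [[0, 1/2]]. *)
Definition ramp (x : R) : R := clamp (4 * x - 2).

Lemma ramp_cts : continuous ramp.
Proof.
move=> x; apply: (@cvg_comp _ _ _ (fun x => 4 * x - 2) (@clamp R)); last exact: clamp_cts.
by apply: cvgB; [exact: mulrl_continuous|exact: cvg_cst].
Qed.

Lemma ramp0 x : x <= 2^-1 -> ramp x = 0.
Proof.
move=> x2; rewrite /ramp /clamp; apply/max_idPl.
by rewrite ge_min; apply/orP; left; lra.
Qed.

Lemma ramp1 x : 3 / 4 <= x -> ramp x = 1.
Proof.
move=> x2; rewrite /ramp /clamp (_ : Num.min _ _ = 1); first by rewrite (max_idPr ler01).
by apply/min_idPr; lra.
Qed.

(** The functions [f + (g + t *: h)] carry over [[3/4, 1]] the isolated points provided by the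
    staircase, on the levels [W + t], while their values over [[0, 1/2]] do not depend on
    [t]. If a Borel hull had only null translates, Tonelli in [(f, t)] would
    give an [f] in the equicontinuous family such that [f + (g + t *: h)] avoids it for
    almost every [t], against [occupation_meets]. *)
Lemma not_shy_isolated_levels (A : set (C01 R)) :
  (forall f : C01 R, (0 < occupation_measure f
     [set y : R | ~ perfect_set (f @^-1` [set y])])%E -> A f) -> ~ shy A.
Proof.
move=> AP [B [mu [mB AB muB]]].
have [d [d0 mud]] := probability_equicts mu.
have r0 : 0 < 4^-1 :> R by rewrite invr_gt0.
have [G [s [cG /andP[s0 s4] GP]]] := exists_isolating (3 / 4) d0 r0.
pose g := restr cG; pose h := restr ramp_cts.
have mN := measurable_affine_path g h mB.
set N := [set _ | _] in mN.
have [Z [mZ Z0 NZ]] : {ae mu, forall f, lebesgue_measure (xsection N f) = 0%E}.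
  apply: (ae_null_sections (m2 := lebesgue_measure) mN).
  apply/nearW => t; rewrite -(muB (- (g + t *: h))); congr (mu _).
  apply/seteqP; split => [f|_ [f Bf <-]].
    by move=> /ysectionP Bf; exists (f + (g + t *: h)) => //; rewrite addrK.
  by apply/ysectionP; rewrite /N /= subrK.
have [f df nZ] : exists2 f, equicts d f & ~ Z f.
  apply: contrapT => nf; move: mud; rewrite ltNge => /negP; apply.
  rewrite -Z0; apply: le_measure; rewrite ?inE//; first exact: measurable_equicts.
  by move=> f df; apply: contrapT => nZ; apply: nf; exists f.
have Nf : lebesgue_measure (xsection N f) = 0%E.
  by apply: contrapT => nN; apply: nZ; apply: NZ.
have [W [mW W0 WP]] := GP f df.
apply: (@occupation_meets (ext (f + g)) W _ mW W0); first exact: ext_cts.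
exists (xsection N f); split => //.
  exact: (@measurable_xsection _ _ (borel (C01 R)) (measurableTypeR R) N f mN).
move=> t /= nt; apply/xsectionP; rewrite /N /=; apply: AB; apply: AP.
set F := f + _; rewrite occupation_measureE lt_neqAle leb_ge0 andbT; apply/eqP => F0; apply: nt.
apply/eqP; rewrite eq_le leb_ge0 andbT [leRHS]F0; apply: leb_mono => x [/andP[x0 x2] Wx].
have x01 : 0 <= x <= 1 by lra.
split => //; apply/not_perfectP.
have [z [/andP[z1 z2] Fz zP]] := WP _ Wx.
have extF v : 3 / 4 <= v <= 1 -> ext F v = ext f v + G v + t.
  move=> v34; rewrite /F !extD extZ !ext_restr; [|lra..].
  by rewrite ramp1 ?mulr1 ?addrA//; lra.
have Fx : ext F x = ext (f + g) x.
  by rewrite /F !extD extZ [ext h x]ext_restr// ramp0// mulr0 addr0.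
exists z; split; first lra.
  by rewrite extF; [rewrite Fz Fx subrK|lra].
exists (Num.min (z - 3 / 4) (3 / 4 + s - z)); first by rewrite lt_min !subr_gt0 z1.
move=> z' z'01; rewrite lt_min ltr_norml ltr_norml => /andP[/andP[? ?] /andP[? ?]].
have z'I : 3 / 4 < z' < 3 / 4 + s by lra.
rewrite !extF; [|lra..]; move=> e; apply: zP => //.
by rewrite -Fz; lra.
Qed.

End not_shy.

Theorem theorem4p3 (R : realType) :
  haar_ambivalent
    [set f : C01 R |
      (0 < occupation_measure f
             [set y : R | ~ perfect_set (f @^-1` [set y])])%E].
Proof.
split.
  exact: not_shy_isolated_levels.
apply: not_prevalent_sawtooth => f /sawtooth_perfect_ae /= ->.
by rewrite ltxx.
Qed.
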